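(* Let $p$ be a prime, $1/2\le\alpha<1$, $\gamma=1-\alpha$, $\beta<\alpha^3$, and suppose $\epsilon=\alpha^3-\beta\ge\gamma^2$. Then $n_p(\alpha,\beta)\le 3\log_p(1/\gamma)$.
   Context: For a prime $p$, $A\subseteq\mathbb{F}_p^n$ has density $|A|/p^n$; the density of 3-APs in $A$ with common difference $d$ is $p^{-n}|\{x: x,x+d,x+2d\in A\}|$. $n_p(\alpha,\beta)$ is the least positive integer $N$ such that for all $n\ge N$ and all $A\subseteq\mathbb{F}_p^n$ of density at least $\alpha$ some nonzero $d$ has 3-AP density at least $\beta$. *)

(* Defs.v *)
From Stdlib Require Import Reals.
From mathcomp Require Import all_boot all_order all_algebra.
Set Implicit Arguments. Unset Strict Implicit. Unset Printing Implicit Defensive.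
Import GRing.Theory.

Section AP.
Local Open Scope ring_scope.
Definition ap3_count (p n : nat) (A : {set 'rV['F_p]_n}) (d : 'rV['F_p]_n) : nat :=
  #|[set x : 'rV['F_p]_n | [&& x \in A, x + d \in A & x + d *+ 2 \in A]]|.

Definition nonzero_vec (p n : nat) (d : 'rV['F_p]_n) : bool := d != 0.
End AP.

Definition density (p n : nat) (A : {set 'rV['F_p]_n}) : R :=
  Rdiv (INR #|A|) (INR (expn p n)).

Definition ap3_density (p n : nat) (A : {set 'rV['F_p]_n}) (d : 'rV['F_p]_n) : R :=
  Rdiv (INR (ap3_count A d)) (INR (expn p n)).

Definition good_dim (p : nat) (alpha beta : R) (n : nat) : Prop :=
  forall A : {set 'rV['F_p]_n}, Rge (density A) alpha ->
    exists d : 'rV['F_p]_n, nonzero_vec d /\ Rge (ap3_density A d) beta.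

(* Main.v *)
Require Import Defs.
From Stdlib Require Import Reals Lra Psatz.
From mathcomp Require Import all_boot all_order all_algebra zify.
Set Implicit Arguments. Unset Strict Implicit. Unset Printing Implicit Defensive.
Import GRing.Theory.

(* Let N = |G|, b = |G \ A| and T(d) the number of 3-APs of difference d in A.
   For a progression (x, x+d, x+2d) not contained in A, the number of its terms
   outside A exceeds the number of its consecutive pairs outside A.  Summing
   over x and d, each pair sweeps out (G \ A)^2 once, so
   sum_d T(d) >= N^2 - 3Nb + 2b^2 = |A| (|A| - b).  As T(0) = |A|, some d <> 0
   has (N - 1) T(d) >= |A| (|A| - b - 1), and for density alpha >= 1/2 with
   N (1 - alpha)^3 >= 1 the right-hand side exceeds (alpha^3 - (1 - alpha)^2) N (N - 1). *)

Lemma exists_max_off_point (T : finType) (F : T -> nat) (x0 : T) :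
  1 < #|T| -> exists2 y, y != x0 & \sum_x F x <= F x0 + #|T|.-1 * F y.
Proof.
move=> T_gt1; have : 0 < #|predC1 x0| by rewrite cardC1 -ltnS prednK // ltnW.
case/(eq_bigmax_cond F) => y y_ne_x0 Fy_max; exists y => //.
rewrite (bigD1 x0) //= leq_add2l -(cardC1 x0) -sum_nat_const.
by apply: leq_sum => x x_ne_x0; rewrite -Fy_max (leq_bigmax_cond (P := predC1 x0)).
Qed.

Section AP3Count.
Variables (G : finZmodType) (A : {set G}).

Definition ap3_num (d : G) : nat :=
  #|[set x | [&& x \in A, (x + d)%R \in A & (x + d *+ 2)%R \in A]]|.

Lemma sum_translate (F : G -> nat) (c : G) : \sum_x F (x + c)%R = \sum_x F x.
Proof. by rewrite [RHS](reindex_inj (addIr c)). Qed.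

Lemma sum_mul_translate (F : G -> nat) :
  \sum_d \sum_x F x * F (x + d)%R = (\sum_x F x) ^ 2.
Proof.
rewrite exchange_big /= -mulnn big_distrl /=; apply: eq_bigr => x _.
by rewrite -big_distrr /= [X in _ = _ * X](reindex_inj (addrI x)).
Qed.

Lemma ap3_num0 : ap3_num 0%R = #|A|.
Proof. by apply: eq_card => x; rewrite inE mul0rn !addr0 !andbb. Qed.

Lemma ap3_numE d :
  ap3_num d = \sum_x [&& x \in A, (x + d)%R \in A & (x + d *+ 2)%R \in A].
Proof. by rewrite /ap3_num -sum1dep_card big_mkcond; apply: eq_bigr => x _; case: (_ && _). Qed.

Lemma sum_notin : \sum_x (x \notin A) = #|~: A|.
Proof.
by rewrite -sum1_card [RHS]big_mkcond; apply: eq_bigr => x _; rewrite inE; case: (x \in A).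
Qed.

Lemma ap3_pointwise (a b c : bool) :
  1 + ~~ a * ~~ b + ~~ b * ~~ c <= [&& a, b & c] + ~~ a + ~~ b + ~~ c.
Proof. by case: a; case: b; case: c. Qed.

Lemma sum_ap3_num_lower :
  #|G| ^ 2 + 2 * #|~: A| ^ 2 <= \sum_d ap3_num d + 3 * (#|G| * #|~: A|).
Proof.
set out := fun x : G => nat_of_bool (x \notin A).
have sum_shifted (f : G -> G) : \sum_d \sum_x out (x + f d)%R = #|G| * #|~: A|.
  by rewrite -sum_nat_const; apply: eq_bigr => d _; rewrite sum_translate sum_notin.
have pairs : \sum_d \sum_x out x * out (x + d)%R = #|~: A| ^ 2.
  by rewrite sum_mul_translate sum_notin.
have pairs2 : \sum_d \sum_x out (x + d)%R * out (x + d *+ 2)%R = #|~: A| ^ 2.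
  rewrite -pairs; apply: eq_bigr => d _.
  rewrite -(sum_translate (fun x => out x * out (x + d)%R) d).
  by apply: eq_bigr => x _; rewrite mulr2n addrA.
have : \sum_d \sum_x (1 + out x * out (x + d)%R + out (x + d)%R * out (x + d *+ 2)%R)
    <= \sum_d \sum_x ([&& x \in A, (x + d)%R \in A & (x + d *+ 2)%R \in A]
                     + out x + out (x + d)%R + out (x + d *+ 2)%R).
  by apply: leq_sum => d _; apply: leq_sum => x _; apply: ap3_pointwise.
under eq_bigr do rewrite !big_split /=.
under [X in _ <= X]eq_bigr do rewrite !big_split /=.
have sum_const (c : nat) : \sum_(x : G) c = #|G| * c by rewrite sum_nat_const.
rewrite !big_split /= pairs pairs2 !sum_const muln1 sum_notin.
under [X in _ <= X + _ + _ + _]eq_bigr do rewrite -ap3_numE.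
rewrite (sum_shifted (fun d => d)) (sum_shifted (fun d => d *+ 2)%R) mulnn.
(* Both sides contain convertible but syntactically different copies of these
   terms (different instance paths); naming them lets lia identify them. *)
set T := \sum_d ap3_num d; set c := #|~: A|; set N := #|G|; lia.
Qed.

End AP3Count.

Section RealBounds.
Local Open Scope R_scope.

Lemma Rle_div_r (x y N : R) : 0 < N -> (x <= y / N) <-> (x * N <= y).
Proof.
move=> N_gt0; have Ninv_gt0 : 0 < / N by apply: Rinv_0_lt_compat.
split=> le_xy.
- have -> : y = y / N * N by field; lra.
  by apply: Rmult_le_compat_r; lra.
- have -> : x = x * N / N by field; lra.
  by apply: Rmult_le_compat_r; lra.
Qed.

Lemma ap3_count_bound (g be N b S t : R) :
  0 < g <= 1 / 2 -> be <= (1 - g) ^ 3 - g ^ 2 -> 1 <= N * g ^ 3 ->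
  0 <= b <= g * N -> N ^ 2 + 2 * b ^ 2 <= S + 3 * (N * b) ->
  S <= (N - b) + (N - 1) * t -> be * N <= t.
Proof.
move=> [g_gt0 g_le_half] be_le Ng3_ge1 [b_ge0 b_le] S_ge S_le.
have N_ge8 : 8 <= N.
  have : g ^ 3 <= (1 / 2) ^ 3 by apply: pow_incr; lra.
  nra.
have S_lower : (N - b) * (N - 2 * b - 1) <= (N - 1) * t by nra.
(* (N - b)(N - 2b - 1) is decreasing in b on [0, N/2]. *)
have monotone : (1 - g) * N * ((1 - 2 * g) * N - 1) <= (N - b) * (N - 2 * b - 1).
  have : 0 <= (g * N - b) * (3 * N - 1 - 2 * b - 2 * g * N) by apply: Rmult_le_pos; nra.
  nra.
have cubic : be * N * (N - 1) <= (1 - g) * N * ((1 - 2 * g) * N - 1).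
  have : 0 <= N * (N * g ^ 3 - 1 + (1 - g) * (1 - g + g ^ 2)) by apply: Rmult_le_pos; nra.
  have : be * (N * (N - 1)) <= ((1 - g) ^ 3 - g ^ 2) * (N * (N - 1)).
    by apply: Rmult_le_compat_r; nra.
  nra.
nra.
Qed.

Lemma ap3_density_bound (al be N a b S t : R) :
  1 / 2 <= al < 1 -> be <= al ^ 3 - (1 - al) ^ 2 -> 1 <= N * (1 - al) ^ 3 ->
  a + b = N -> 0 <= b -> al <= a / N ->
  N ^ 2 + 2 * b ^ 2 <= S + 3 * (N * b) -> S <= a + (N - 1) * t -> be <= t / N.
Proof.
move=> [al_ge al_lt1] be_le Ng3_ge1 abN b_ge0 al_le S_ge S_le.
have g3_gt0 : 0 < (1 - al) ^ 3 by apply: pow_lt; lra.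
have N_gt0 : 0 < N by nra.
have b_le : b <= (1 - al) * N.
  by move: al_le; rewrite Rle_div_r //; lra.
suff : be * N <= t by rewrite Rle_div_r //; lra.
apply: (ap3_count_bound (g := 1 - al) (b := b) (S := S)); lra.
Qed.

Lemma pow_ge_of_log_ratio (P g : R) (n : nat) :
  1 < P -> 0 < g -> 3 * (ln (1 / g) / ln P) <= INR n -> 1 <= P ^ n * g ^ 3.
Proof.
move=> P_gt1 g_gt0 n_ge.
have lnP_gt0 : 0 < ln P by rewrite -ln_1; apply: ln_increasing; lra.
have : 3 * ln (1 / g) <= INR n * ln P.
  have -> : 3 * ln (1 / g) = 3 * (ln (1 / g) / ln P) * ln P by field; lra.
  by apply: Rmult_le_compat_r; lra.
have Pn_gt0 : 0 < P ^ n by apply: pow_lt; lra.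
have g3_gt0 : 0 < g ^ 3 by apply: pow_lt.
rewrite -ln_pow; last lra.
rewrite Rdiv_1_l ln_Rinv // => ln_ge.
have ln_g3 : ln (g ^ 3) = 3 * ln g by rewrite ln_pow //=; ring.
have ln_ge0 : 0 <= ln (P ^ n * g ^ 3) by rewrite ln_mult //; lra.
case: (Rle_or_lt 1 (P ^ n * g ^ 3)) => // lt1.
by have := ln_increasing _ _ (Rmult_lt_0_compat _ _ Pn_gt0 g3_gt0) lt1; rewrite ln_1; lra.
Qed.

Lemma INR_expn (m k : nat) : INR (m ^ k) = INR m ^ k.
Proof. by elim: k => //= k IH; rewrite expnS mult_INR IH. Qed.

Lemma INR_leq (m k : nat) : (m <= k)%N -> INR m <= INR k.
Proof. by move/leP/le_INR. Qed.

Lemma INR_pred (m : nat) : (0 < m)%N -> INR m.-1 = INR m - 1.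
Proof. by case: m => // m _; rewrite S_INR /=; ring. Qed.

End RealBounds.

Theorem mainTheorem12 (p : nat) (alpha beta : R) :
  prime p ->
  Rle (1 / 2) alpha -> Rlt alpha 1 ->
  Rlt beta (alpha ^ 3) ->
  Rge (alpha ^ 3 - beta) ((1 - alpha) ^ 2) ->
  forall n : nat, (1 <= n)%N ->
    Rle (3 * (ln (1 / (1 - alpha)) / ln (INR p))) (INR n) ->
    good_dim p alpha beta n.
Proof.
move=> p_prime al_ge al_lt1 _ eps_ge n n_ge1 n_ge A densA.
have card_V : #|{: 'rV['F_p]_n}| = p ^ n by rewrite card_mx card_Fp // mul1n.
have V_gt1 : 1 < #|{: 'rV['F_p]_n}|.
  rewrite card_V; apply: leq_trans (prime_gt1 p_prime) _.
  by rewrite -{1}(expn1 p) leq_pexp2l // prime_gt0.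
have [d d_ne0 sum_le] := exists_max_off_point (ap3_num A) 0%R V_gt1.
exists d; split => //.
have lower := sum_ap3_num_lower A.
have card_split := cardsC A.
rewrite card_V in sum_le lower card_split; rewrite ap3_num0 in sum_le.
(* Identifies the two instance paths of #|~: A|, as in sum_ap3_num_lower. *)
set c := #|~: A| in lower card_split *.
apply/Rle_ge/(ap3_density_bound (al := alpha) (a := INR #|A|) (b := INR c)
                (S := INR (\sum_d ap3_num A d))).
- lra.
- lra.
- rewrite INR_expn; apply: pow_ge_of_log_ratio => //; last lra.
  by apply: (lt_INR 1); apply/ltP; apply: prime_gt1.
- by rewrite -card_split plus_INR.
- exact: pos_INR.
- exact: Rge_le.
- by have := INR_leq lower; rewrite !plus_INR !mult_INR !INR_expn INR_0; lra.
- by have := INR_leq sum_le; rewrite plus_INR mult_INR INR_pred // expn_gt0 prime_gt0.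
Qed.
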